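(* Let $H_1,H_2\in(0,1)$ with $H_1<H_2$, let $(a,b)\in\mathbb{R}^2\setminus\{(0,0)\}$, and let $B^{H_1}$ and $B^{H_2}$ be independent fractional Brownian motions with Hurst exponents $H_1$ and $H_2$. Then the fractional mixed fractional Brownian motion $N^{H_1H_2}(a,b)=\{N^{H_1H_2}_t(a,b),\ t\ge 0\}$ defined by $$N^{H_1H_2}_t(a,b)=aB^{H_1}_t+bB^{H_2}_t,\qquad t\ge 0,$$ has the long range dependence property.
   Context: A fractional Brownian motion $B^H=\{B^H_t,\ t\ge 0\}$ with Hurst exponent $H\in(0,1)$ is the centered Gaussian process with continuous paths, $B^H_0=0$, and covariance $E(B^H_tB^H_s)=\frac12\left(t^{2H}+s^{2H}-|t-s|^{2H}\right)$. For centered square-integrable random variables $U,V$ on the same probability space, $\mathrm{Corr}(U,V)=\dfrac{\mathrm{Cov}(U,V)}{\sqrt{E(U^2)E(V^2)}}$. Long range dependence (for a not necessarily stationary process): a process $\{X_t,\ t\ge 0\}$ has the long range dependence property if there is $d\in(0,1)$ such that for each fixed $s>0$, $\mathrm{Corr}(X_t,X_s)\sim c(s)\,t^{-d}$ as $t\to\infty$, where $c(s)$ is a constant depending on $s$. Here $f(t)\sim g(t)$ means $f(t)/g(t)\to 1$ (so $c(s)\ne 0$). *)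

(* Defs.v *)
From HB Require Import structures.
From mathcomp Require Import all_boot all_order all_algebra.
From mathcomp Require Import all_classical all_reals all_analysis.
From mathcomp Require Import measurable_realfun.

Set Implicit Arguments.
Unset Strict Implicit.
Unset Printing Implicit Defensive.

Import Order.TTheory GRing.Theory Num.Theory.
Import numFieldNormedType.Exports.

Local Open Scope classical_set_scope.
Local Open Scope ring_scope.

(* A process {X_t, t >= 0} is a map X : R -> {RV P >-> R}; all the notions
   below only look at its values at times t >= 0. *)

(* Gaussian law with mean m and standard deviation s. The degenerate case s = 0
   is the Dirac mass at m (normal_prob m 0 is a uniform law by convention). *)
Definition gaussian_law (R : realType) (m s : R) : set R -> \bar R :=
  if s == 0 then \d_m else normal_prob m s.

Definition gaussian_rv d (T : measurableType d) (R : realType)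
    (P : probability T R) (X : {RV P >-> R}) : Prop :=
  exists m s : R, forall A : set R, measurable A ->
    distribution P X A = gaussian_law m s A.

Definition gaussian_process d (T : measurableType d) (R : realType)
    (P : probability T R) (X : R -> {RV P >-> R}) : Prop :=
  forall (n : nat) (t c : 'I_n -> R), (forall i, 0 <= t i) ->
    gaussian_rv (P := P)
      (\sum_(i < n) scale_mfun (c i) (X (t i))).

Definition centered_square_integrable d (T : measurableType d) (R : realType)
    (P : probability T R) (U : {RV P >-> R}) : Prop :=
  (U : T -> R) \in Lfun P 2%:E /\ ('E_P[U] = 0)%E.

Record is_fBm d (T : measurableType d) (R : realType) (P : probability T R)
    (H : R) (B : R -> {RV P >-> R}) : Prop := IsFBm {
  fBm_gaussian : gaussian_process B;
  fBm_centered : forall t : R, 0 <= t -> ('E_P[B t] = 0)%E;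
  fBm_continuous :
    forall w, {within `[0, +oo[, continuous (fun t : R => B t w)};
  fBm_0 : forall w, B 0 w = 0;
  fBm_cov : forall t s : R, 0 <= t -> 0 <= s ->
    'E_P[B t \* B s]%E =
      (2^-1 * (t `^ (2 * H) + s `^ (2 * H) - `|t - s| `^ (2 * H)))%:E }.

Definition process_sigma_algebra d (T : measurableType d) (R : realType)
    (P : probability T R) (X : R -> {RV P >-> R}) : set (set T) :=
  <<s \bigcup_(t in `[0, +oo[) preimage_set_system setT (X t) measurable >>.

Definition independent_processes d (T : measurableType d) (R : realType)
    (P : probability T R) (X Y : R -> {RV P >-> R}) : Prop :=
  forall A B : set T, process_sigma_algebra X A -> process_sigma_algebra Y B ->
    P (A `&` B) = (P A * P B)%E.

Definition Corr d (T : measurableType d) (R : realType) (P : probability T R)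
    (U V : {RV P >-> R}) : R :=
  fine (covariance P U V) /
    Num.sqrt (fine 'E_P[U ^+ 2]%E * fine 'E_P[V ^+ 2]%E).

Definition asymp_equiv (R : realType) (f g : R -> R) : Prop :=
  f t / g t @[t --> +oo] --> (1 : R).

(* Correlations being defined for centered square-integrable variables, this is
   part of the notion. The constant c is nonzero, for otherwise the quotient in
   asymp_equiv would be identically 0. *)
Definition long_range_dependent d (T : measurableType d) (R : realType)
    (P : probability T R) (X : R -> {RV P >-> R}) : Prop :=
  (forall t : R, 0 <= t -> centered_square_integrable (X t)) /\
  exists d0 : R, 0 < d0 < 1 /\
    forall s : R, 0 < s -> exists c : R,
      asymp_equiv (fun t => Corr (X t) (X s)) (fun t => c * t `^ (- d0)).

Definition fmfBm d (T : measurableType d) (R : realType) (P : probability T R)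
    (a b : R) (B1 B2 : R -> {RV P >-> R}) (t : R) : {RV P >-> R} :=
  scale_mfun a (B1 t) + scale_mfun b (B2 t).

(* Main.v *)
Require Import Defs.
From HB Require Import structures.
From mathcomp Require Import all_boot all_order all_algebra.
From mathcomp Require Import all_classical all_reals all_analysis.
From mathcomp Require Import measurable_realfun ring lra.

Set Implicit Arguments.
Unset Strict Implicit.
Unset Printing Implicit Defensive.

Import Order.TTheory GRing.Theory Num.Theory.
Import numFieldNormedType.Exports.

Local Open Scope classical_set_scope.
Local Open Scope ring_scope.

(** The sum N = a B1 + b B2 of two independent centered processes has
    E[N_t N_s] = a^2 r_{H1}(t, s) + b^2 r_{H2}(t, s), where
    r_H(t, s) = (t^{2H} + s^{2H} - |t - s|^{2H}) / 2: the cross terms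
    E[B1_t B2_s] factor by independence ([expectationM_indep]) and vanish by
    centering. The correlation of N is therefore an explicit function of (t, s)
    ([fmfBm_Corr]), and only its behaviour as t tends to +oo matters.

    For fixed s > 0, t^{2H} - (t - s)^{2H} is equivalent to 2 H s t^{2H-1}
    ([powR_increment_cvgy]), so r_H(t, s) has the exact order t^{e_H} with
    e_H = max(0, 2H - 1): for H > 1/2 the increment term dominates, for
    H < 1/2 the constant s^{2H} / 2 does, and for H = 1/2 both contribute, with
    the same sign ([fBm_kernel_cvgy], [fBm_kernel_lim_gt0]). As H |-> e_H and
    H |-> t^{2H}, for t >= 1, are nondecreasing, the largest Hurst exponent K
    among those with a nonzero weight governs the covariance, of order t^{e_K}, and the
    variance, of order t^{2K}; a smaller exponent can only add a nonnegative
    contribution to the limits, so no cancellation occurs. Hence the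
    correlation decays like t^{e_K - K} ([mixed_kernel_corr_cvgy]), and
    K - e_K = min(K, 1 - K) is in (0, 1) because K is.

    When b is nonzero, K = H2. When b = 0 the process is a B1 and K = H1. *)

(** * Power functions at infinity *)

(** Writing the limit as an indicator treats the constant and the vanishing
    power at once, so that exponents need no case analysis later. *)
Lemma powR_cvgy (R : realType) (a : R) : a <= 0 ->
  t `^ a @[t --> +oo] --> ((a == 0)%:R : R).
Proof.
rewrite le_eqVlt => /predU1P[->|a0].
  rewrite eqxx; under eq_fun do rewrite powRr0.
  exact: cvg_cst.
rewrite lt_eqF//; apply/cvgr0Pnorm_lt => e e0; near=> t.
have t0 : 0 < t by near: t; exact: nbhs_pinfty_gt.
rewrite ger0_norm ?powR_ge0// -[a]opprK powRN invf_plt ?posrE ?powR_gt0//.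
have Na0 : 0 < - a by rewrite oppr_gt0.
have eE : e^-1 = (e^-1 `^ (- a)^-1) `^ (- a).
  by rewrite -powRrM mulVf ?gt_eqF// powRr1// invr_ge0 ltW.
rewrite eE; apply: gt0_ltr_powR => //.
- by rewrite nnegrE powR_ge0.
- by rewrite nnegrE ltW.
Unshelve. all: by end_near. Qed.

(** With u = - s / t, the quotient is s times the slope
    ((1 + u)^h - 1) / u of the power function at 1, and u tends to 0 through
    nonzero values. *)
Lemma powR_increment_cvgy (R : realType) (h s : R) : 0 < s ->
  (t `^ h - (t - s) `^ h) / t `^ (h - 1) @[t --> +oo] --> h * s.
Proof.
move=> s0.
have [dh Dh] := @is_derive1_powR R h 1 ltr01.
have slope : u^-1 * ((u + 1) `^ h - 1) @[u --> 0^'] --> h.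
  have [l hl] := (cvg_ex _).1 dh.
  have lh : l = h.
    by move: Dh; rewrite powR1 mulr1 => <-; apply/esym/cvg_lim.
  rewrite lh in hl; apply: cvg_trans hl.
  apply: near_eq_cvg; near=> u => /=.
  by rewrite powR1 [u%:A]mulr1.
have small : - s / t @[t --> +oo] --> (0 : R)^'.
  have : - s * t `^ (- 1) @[t --> +oo] --> (0 : R).
    rewrite -[X in _ --> X](mulr0 (- s)); apply: cvgM; first exact: cvg_cst.
    have := @powR_cvgy R (-1); rewrite oppr_eq0 oner_eq0; apply.
    by rewrite lerN10.
  move=> st0 A A0.
  have {}st0 : \forall t \near +oo,
    - s * t `^ (-1) != 0 -> A (- s * t `^ (-1)) := st0 _ A0.
  suff : \forall t \near +oo, A (- s / t) by [].
  near=> t.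
  have t0 : 0 < t by near: t; exact: nbhs_pinfty_gt.
  have : - s * t `^ (-1) != 0 -> A (- s * t `^ (-1)) by near: t.
  rewrite powR_inv1 ?ltW//; apply.
  by rewrite mulf_neq0 ?oppr_eq0 ?invr_eq0 ?gt_eqF.
have lim : (- s / t)^-1 * ((- s / t + 1) `^ h - 1) * s @[t --> +oo] --> h * s.
  apply: cvgM; last exact: cvg_cst.
  exact: (cvg_comp _ _ small slope).
apply: cvg_trans lim.
apply: near_eq_cvg; near=> t => /=.
have t0 : 0 < t by near: t; exact: nbhs_pinfty_gt.
have ts : s < t by near: t; apply: nbhs_pinfty_gt; rewrite num_real.
have -> : - s / t + 1 = (t - s) / t by field; rewrite gt_eqF.
have -> : ((t - s) / t) `^ h = (t - s) `^ h / t `^ h.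
  rewrite powRM ?subr_ge0 ?invr_ge0 ?(ltW ts) ?(ltW t0)//.
  by rewrite -(powR_inv1 (ltW t0)) -powRrM mulN1r powRN.
have -> : t `^ (h - 1) = t `^ h / t.
  by rewrite powRB ?(gt_eqF t0) ?implybT// powRr1 ?ltW.
have th0 : 0 < t `^ h by rewrite powR_gt0.
field.
by rewrite !gt_eqF.
Unshelve. all: by end_near. Qed.

(** * Asymptotics of mixed covariance kernels *)

Definition fBm_kernel (R : realType) (H t s : R) : R :=
  2^-1 * (t `^ (2 * H) + s `^ (2 * H) - `|t - s| `^ (2 * H)).

Definition mixed_kernel (R : realType) (p q H K t s : R) : R :=
  p * fBm_kernel H t s + q * fBm_kernel K t s.

Lemma fBm_kernel_diag (R : realType) (H t : R) : 0 < H ->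
  fBm_kernel H t t = t `^ (2 * H).
Proof.
move=> H0; rewrite /fBm_kernel subrr normr0 powR0 ?gt_eqF ?mulr_gt0//.
by rewrite subr0; field.
Qed.

(** The limit of r_H(t, s) / t^e: each of the two competing terms, the increment
    and the constant s^{2H}, survives exactly when its order is t^e. *)
Definition fBm_kernel_lim (R : realType) (H s e : R) : R :=
  2^-1 * ((2 * H - 1 == e)%:R * (2 * H * s) + (e == 0)%:R * s `^ (2 * H)).

(** The exponent e may exceed the true order of the kernel, which is what the
    subordinate component of a mixture needs. *)
Lemma fBm_kernel_cvgy (R : realType) (H s e : R) :
  0 < s -> 0 <= e -> 2 * H - 1 <= e ->
  fBm_kernel H t s / t `^ e @[t --> +oo] --> fBm_kernel_lim H s e.
Proof.
move=> s0 e0 He.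
have lim : 2^-1 * (t `^ (2 * H - 1 - e) *
      ((t `^ (2 * H) - (t - s) `^ (2 * H)) / t `^ (2 * H - 1)) +
    t `^ (- e) * s `^ (2 * H)) @[t --> +oo] --> fBm_kernel_lim H s e.
  apply: cvgM; first exact: cvg_cst.
  apply: cvgD; apply: cvgM.
  - by rewrite -subr_eq0; apply: powR_cvgy; rewrite subr_le0.
  - exact: powR_increment_cvgy.
  - by rewrite -(oppr_eq0 e); apply: powR_cvgy; rewrite oppr_le0.
  - exact: cvg_cst.
apply: cvg_trans lim; apply: near_eq_cvg; near=> t => /=.
have t0 : 0 < t by near: t; exact: nbhs_pinfty_gt.
have ts : s < t by near: t; apply: nbhs_pinfty_gt; rewrite num_real.
rewrite /fBm_kernel gtr0_norm ?subr_gt0// powRN.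
rewrite (@powRB _ t (2 * H - 1)) ?(gt_eqF t0) ?implybT//.
have te0 : t `^ e != 0 by rewrite gt_eqF ?powR_gt0.
have th0 : t `^ (2 * H - 1) != 0 by rewrite gt_eqF ?powR_gt0.
by field; rewrite te0.
Unshelve. all: by end_near. Qed.

Lemma fBm_kernel_lim_ge0 (R : realType) (H s e : R) : 0 <= H -> 0 <= s ->
  0 <= fBm_kernel_lim H s e.
Proof.
by move=> H0 s0; rewrite mulr_ge0// addr_ge0// !mulr_ge0 ?ler0n ?powR_ge0.
Qed.

(** At e = max(0, 2H - 1) at least one of the two nonnegative terms survives. *)
Lemma fBm_kernel_lim_gt0 (R : realType) (H s : R) : 0 < H -> 0 < s ->
  0 < fBm_kernel_lim H s (Num.max 0 (2 * H - 1)).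
Proof.
move=> H0 s0; rewrite mulr_gt0 ?invr_gt0//.
case: (leP 0 (2 * H - 1)) => Hhalf.
  rewrite eqxx mul1r ltr_pwDl ?mulr_ge0 ?ler0n ?powR_ge0//.
  by rewrite !mulr_gt0.
by rewrite eqxx mul1r lt_eqF// mul0r add0r powR_gt0.
Qed.

Lemma mixed_kernel_diag_cvgy (R : realType) (p q H K : R) :
  0 < H <= K ->
  mixed_kernel p q H K t t / t `^ (2 * K) @[t --> +oo]
    --> p * (H == K)%:R + q.
Proof.
move=> /andP[H0 HK].
have lim : p * t `^ (2 * (H - K)) + q @[t --> +oo] --> p * (H == K)%:R + q.
  apply: cvgD; last exact: cvg_cst.
  apply: cvgM; first exact: cvg_cst.
  have -> : (H == K) = (2 * (H - K) == 0).
    by rewrite mulf_eq0 pnatr_eq0/= subr_eq0.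
  by apply: powR_cvgy; rewrite pmulr_rle0// subr_le0.
apply: cvg_trans lim; apply: near_eq_cvg; near=> t => /=.
have t0 : 0 < t by near: t; exact: nbhs_pinfty_gt.
have K0 : 0 < K by exact: lt_le_trans HK.
rewrite /mixed_kernel !fBm_kernel_diag// mulrBr.
rewrite powRB ?(gt_eqF t0) ?implybT//.
have tK0 : t `^ (2 * K) != 0 by rewrite gt_eqF ?powR_gt0.
by field.
Unshelve. all: by end_near. Qed.

Lemma mixed_kernel_diag_gt0 (R : realType) (p q H K s : R) :
  0 <= p -> 0 < q -> 0 < H -> 0 < K -> 0 < s -> 0 < mixed_kernel p q H K s s.
Proof.
move=> p0 q0 H0 K0 s0; rewrite /mixed_kernel !fBm_kernel_diag//.
by rewrite ltr_wpDl ?mulr_ge0 ?mulr_gt0 ?powR_ge0 ?powR_gt0.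
Qed.

Definition kernel_corr (R : realType) (C : R -> R -> R) (t s : R) : R :=
  C t s / Num.sqrt (C t t * C s s).

(** Numerator and variance are normalised by t^e and t^{2K}, with
    e = max(0, 2K - 1); both limits are positive because p is nonnegative and
    q positive. The case H = K is allowed: it covers a process that has a
    single component, by taking p = 0. *)
Lemma mixed_kernel_corr_cvgy (R : realType) (p q H K s : R) :
  0 <= p -> 0 < q -> 0 < H <= K -> 0 < s ->
  exists2 c : R, 0 < c &
    kernel_corr (mixed_kernel p q H K) t s / t `^ (Num.max 0 (2 * K - 1) - K)
      @[t --> +oo] --> c.
Proof.
move=> p0 q0 HK s0; set e := Num.max 0 (2 * K - 1).
have /andP[H0 leHK] := HK.
have K0 : 0 < K by exact: lt_le_trans leHK.
have e0 : 0 <= e by rewrite le_max lexx.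
have Ke : 2 * K - 1 <= e by rewrite le_max lexx orbT.
have He : 2 * H - 1 <= e.
  by apply: le_trans Ke; rewrite lerB// ler_pM2l.
have Vs0 : 0 < mixed_kernel p q H K s s by exact: mixed_kernel_diag_gt0.
pose k := p * fBm_kernel_lim H s e + q * fBm_kernel_lim K s e.
have k0 : 0 < k.
  rewrite /k ltr_wpDl//.
    by rewrite mulr_ge0// fBm_kernel_lim_ge0// ltW.
  by rewrite mulr_gt0// fBm_kernel_lim_gt0.
pose v := p * (H == K)%:R + q.
have v0 : 0 < v by rewrite ltr_wpDl// mulr_ge0.
exists (k / Num.sqrt (v * mixed_kernel p q H K s s)).
  by rewrite divr_gt0// sqrtr_gt0 mulr_gt0.
have lim : (p * (fBm_kernel H t s / t `^ e) + q * (fBm_kernel K t s / t `^ e)) /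
    Num.sqrt (mixed_kernel p q H K t t / t `^ (2 * K) *
              mixed_kernel p q H K s s) @[t --> +oo]
    --> k / Num.sqrt (v * mixed_kernel p q H K s s).
  apply: cvgM.
    by apply: cvgD; (apply: cvgM; first exact: cvg_cst);
      exact: fBm_kernel_cvgy.
  apply: cvgV; first by rewrite gt_eqF// sqrtr_gt0 mulr_gt0.
  apply: continuous_cvg; first exact: sqrt_continuous.
  apply: cvgM; last exact: cvg_cst.
  exact: mixed_kernel_diag_cvgy.
apply: cvg_trans lim; apply: near_eq_cvg; near=> t => /=.
have t0 : 0 < t by near: t; exact: nbhs_pinfty_gt.
have Vt0 : 0 < mixed_kernel p q H K t t by exact: mixed_kernel_diag_gt0.
have tK0 : 0 < t `^ K by rewrite powR_gt0.
rewrite (_ : _ * mixed_kernel p q H K s s = (mixed_kernel p q H K t t *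
    mixed_kernel p q H K s s) * (t `^ K)^-1 ^+ 2); last first.
  by rewrite mulrAC mulrC [2 * K]mulrC powRrM powR_mulrn ?(ltW tK0)// exprVn mulrC.
rewrite sqrtrM ?mulr_ge0 ?(ltW Vt0) ?(ltW Vs0)// sqrtr_sqr gtr0_norm ?invr_gt0//.
rewrite /kernel_corr {3}/mixed_kernel.
rewrite powRB ?(gt_eqF t0) ?implybT//.
have te0 : t `^ e != 0 by rewrite gt_eqF ?powR_gt0.
have VV0 : Num.sqrt (mixed_kernel p q H K t t * mixed_kernel p q H K s s) != 0.
  by rewrite gt_eqF// sqrtr_gt0 mulr_gt0.
by field; rewrite te0 VV0 gt_eqF.
Unshelve. all: by end_near. Qed.

(** * Expectation of a product of independent variables *)

Lemma integrable_id_distribution d (T : measurableType d) (R : realType)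
    (P : probability T R) (X : {RV P >-> R}) :
  (X : T -> R) \in Lfun P 1 -> (distribution P X).-integrable setT EFin.
Proof.
move=> /Lfun1_integrable/integrableP[_ Xoo]; apply/integrableP; split => //.
by rewrite ge0_integral_distribution//; exact: measurableT_comp.
Qed.

(** Independence says that the joint law of (X, Y) is the product of the
    marginal laws on rectangles, hence everywhere; Fubini's theorem for the
    function (x, y) |-> x y then factors the expectation. *)
Lemma expectationM_indep d (T : measurableType d) (R : realType)
    (P : probability T R) (X Y : {RV P >-> R}) :
  (forall A B : set R, measurable A -> measurable B ->
    P (X @^-1` A `&` Y @^-1` B) = (P (X @^-1` A) * P (Y @^-1` B))%E) ->
  (X : T -> R) \in Lfun P 1 -> (Y : T -> R) \in Lfun P 1 ->
  ('E_P[X \* Y] = 'E_P[X] * 'E_P[Y])%E.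
Proof.
move=> XY_indep X1 Y1.
have mXY : measurable_fun [set: T] (fun w => (X w, Y w)).
  by apply/measurable_fun_pairP; split; exact: measurable_funP.
pose XY : {mfun T >-> (R * R)%type} := HB.pack (fun w => (X w, Y w))
  (isMeasurableFun.Build _ _ _ _ _ mXY).
pose mX := distribution P X; pose mY := distribution P Y.
have iX : mX.-integrable setT EFin := integrable_id_distribution X1.
have iY : mY.-integrable setT EFin := integrable_id_distribution Y1.
pose f (z : R * R) : \bar R := (z.1 * z.2)%:E.
have mf : measurable_fun setT f.
  by apply/measurable_EFinP; exact: measurable_funM.
have lawE (g : R * R -> \bar R) :
    (\int[mX \x mY]_z g z = \int[distribution P XY]_z g z)%E.
  apply: eq_measure_integral => A mA _.
  exact: (product_measure_unique (m' := distribution P XY)).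
(* Tonelli: the integral of |x y| is the product of the two first moments. *)
have if_ : (mX \x mY)%E.-integrable setT f.
  apply/integrable12ltyP => //.
  have mn : measurable_fun [set: R] (fun x : R => `|x%:E|)%E.
    exact: measurableT_comp.
  under eq_integral => x _.
    under eq_integral => y _ do rewrite /f /= normrM EFinM -abse_EFin.
    rewrite ge0_integralZl//.
    over.
  rewrite ge0_integralZr//; last exact: integral_ge0.
  have /integrableP[_ Xoo] := iX; have /integrableP[_ Yoo] := iY.
  by rewrite lte_mul_pinfty// ?integral_ge0// ge0_fin_numE ?integral_ge0.
have ifXY : P.-integrable setT (f \o XY).
  apply/integrableP; split; first exact: measurableT_comp.
  have /integrableP[_] := if_.
  rewrite lawE ge0_integral_distribution//; exact: measurableT_comp.
rewrite unlock.
transitivity (\int[P]_w (f \o XY) w)%E; first by [].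
rewrite -integral_distribution// -lawE -integral12_prod_meas1// /fubini_F.
under eq_integral => x _.
  under eq_integral => y _ do rewrite /f /= EFinM.
  rewrite integralZl//.
  over.
have iYfin : (\int[mY]_y y%:E)%E \is a fin_num by exact: integrable_fin_num.
rewrite -(fineK iYfin) integralZr// fineK//.
by rewrite !integral_distribution//; exact/Lfun1_integrable.
Qed.

(** * Second-order structure of the mixed process *)

Lemma Lfun2_second_moment d (T : measurableType d) (R : realType)
    (P : probability T R) (X : {RV P >-> R}) (m : R) :
  'E_P[X \* X]%E = m%:E -> (X : T -> R) \in Lfun P 2%:E.
Proof.
move=> Em; rewrite inE; apply/andP; split.
  by rewrite inE/=; exact: measurable_funP.
rewrite inE/= /finite_norm unlock /Lnorm poweR_lty//.
move: Em; rewrite unlock => Em.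
rewrite (_ : (\int[P]_x _)%E = m%:E) ?ltry// -Em.
apply: eq_integral => x _ /=.
by rewrite powR_mulrn// -normrX ger0_norm// sqr_ge0.
Qed.

Lemma fBm_Lfun2 d (T : measurableType d) (R : realType) (P : probability T R)
    (H : R) (B : R -> {RV P >-> R}) (t : R) :
  is_fBm H B -> 0 <= t -> (B t : T -> R) \in Lfun P 2%:E.
Proof. by move=> fB t0; apply: Lfun2_second_moment (fBm_cov fB t0 t0). Qed.

Lemma Lfun2_Lfun1 d (T : measurableType d) (R : realType) (P : probability T R)
    (X : T -> R) : X \in Lfun P 2%:E -> X \in Lfun P 1.
Proof. exact/Lfun_subset12/fin_num_measure. Qed.

Lemma independent_processes_marginals d (T : measurableType d) (R : realType)
    (P : probability T R) (X Y : R -> {RV P >-> R}) (t s : R) :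
  independent_processes X Y -> 0 <= t -> 0 <= s ->
  forall A B : set R, measurable A -> measurable B ->
    P (X t @^-1` A `&` Y s @^-1` B) = (P (X t @^-1` A) * P (Y s @^-1` B))%E.
Proof.
move=> XY t0 s0 A B mA mB.
have gen (Z : R -> {RV P >-> R}) (u : R) (C : set R) : 0 <= u -> measurable C ->
    process_sigma_algebra Z (Z u @^-1` C).
  move=> u0 mC; apply: sub_sigma_algebra; exists u; first by rewrite /= in_itv/= u0.
  by exists C => //; rewrite setTI.
by apply: XY; exact: gen.
Qed.

Lemma fBm_cross_expectation d (T : measurableType d) (R : realType)
    (P : probability T R) (H K : R) (B1 B2 : R -> {RV P >-> R}) (t s : R) :
  is_fBm H B1 -> is_fBm K B2 -> independent_processes B1 B2 ->
  0 <= t -> 0 <= s -> ('E_P[B1 t \* B2 s] = 0)%E.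
Proof.
move=> f1 f2 ind t0 s0.
rewrite (expectationM_indep (independent_processes_marginals ind t0 s0)
  (Lfun2_Lfun1 (fBm_Lfun2 f1 t0)) (Lfun2_Lfun1 (fBm_Lfun2 f2 s0))).
by rewrite (fBm_centered f1 t0) mul0e.
Qed.

Lemma fmfBm_centered_square_integrable d (T : measurableType d) (R : realType)
    (P : probability T R) (H K a b : R) (B1 B2 : R -> {RV P >-> R}) (t : R) :
  is_fBm H B1 -> is_fBm K B2 -> 0 <= t ->
  centered_square_integrable (fmfBm a b B1 B2 t).
Proof.
move=> f1 f2 t0.
have NE : (fmfBm a b B1 B2 t : T -> R) = (a \o* B1 t) \+ (b \o* B2 t) by [].
rewrite /centered_square_integrable NE; split.
  apply: rpredD => [|le12|le12]; first by rewrite lee1n.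
    by apply: Lfun_scale; [rewrite ler1n|exact: fBm_Lfun2 f1 t0].
  by apply: Lfun_scale; [rewrite ler1n|exact: fBm_Lfun2 f2 t0].
have l1 := Lfun2_Lfun1 (fBm_Lfun2 f1 t0).
have l2 := Lfun2_Lfun1 (fBm_Lfun2 f2 t0).
rewrite expectationD; [|exact: Lfun_scale..].
rewrite !expectationZl//.
by rewrite (fBm_centered f1 t0) (fBm_centered f2 t0) !mule0 adde0.
Qed.

Lemma fmfBm_second_moments d (T : measurableType d) (R : realType)
    (P : probability T R) (H K a b : R) (B1 B2 : R -> {RV P >-> R}) (t s : R) :
  is_fBm H B1 -> is_fBm K B2 -> independent_processes B1 B2 ->
  0 <= t -> 0 <= s ->
  'E_P[fmfBm a b B1 B2 t \* fmfBm a b B1 B2 s]%E =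
    (mixed_kernel (a ^+ 2) (b ^+ 2) H K t s)%:E.
Proof.
move=> f1 f2 ind t0 s0.
have l1t := fBm_Lfun2 f1 t0; have l2t := fBm_Lfun2 f2 t0.
have l1s := fBm_Lfun2 f1 s0; have l2s := fBm_Lfun2 f2 s0.
have -> : (fmfBm a b B1 B2 t \* fmfBm a b B1 B2 s : T -> R) =
    ((a ^+ 2 \o* (B1 t \* B1 s) \+ (a * b) \o* (B1 t \* B2 s)) \+
     ((a * b) \o* (B1 s \* B2 t) \+ b ^+ 2 \o* (B2 t \* B2 s)))%R.
  have bilin (x y z u : R) : (x * a + y * b) * (z * a + u * b) =
      x * z * a ^+ 2 + x * u * (a * b) + (z * y * (a * b) + y * u * b ^+ 2).
    by ring.
  by apply/funext => w; exact: bilin.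
have L1 c (X Y : T -> R) : X \in Lfun P 2%:E -> Y \in Lfun P 2%:E ->
  c \o* (X \* Y) \in Lfun P 1.
  by move=> lX lY; apply: Lfun_scale => //; exact: Lfun2_mul_Lfun1.
rewrite !expectationD ?rpredD ?L1//.
rewrite !expectationZl; [|exact: Lfun2_mul_Lfun1..].
rewrite !(fBm_cross_expectation f1 f2 ind)// (fBm_cov f1)// (fBm_cov f2)//.
by rewrite !mule0 adde0 add0e -!EFinM -EFinD.
Qed.

Lemma fmfBm_Corr d (T : measurableType d) (R : realType)
    (P : probability T R) (H K a b : R) (B1 B2 : R -> {RV P >-> R}) (t s : R) :
  is_fBm H B1 -> is_fBm K B2 -> independent_processes B1 B2 ->
  0 <= t -> 0 <= s ->
  Corr (fmfBm a b B1 B2 t) (fmfBm a b B1 B2 s) =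
    kernel_corr (mixed_kernel (a ^+ 2) (b ^+ 2) H K) t s.
Proof.
move=> f1 f2 ind t0 s0.
have [lt Et] := fmfBm_centered_square_integrable a b f1 f2 t0.
have [ls Es] := fmfBm_centered_square_integrable a b f1 f2 s0.
have sq u : (fmfBm a b B1 B2 u ^+ 2 : T -> R) =
    fmfBm a b B1 B2 u \* fmfBm a b B1 B2 u.
  by apply/funext => w; rewrite expr2.
rewrite /Corr /kernel_corr covarianceE; [|exact: Lfun2_Lfun1..|
                                           exact: Lfun2_mul_Lfun1].
rewrite Et mul0e sube0 !sq.
by rewrite !(fmfBm_second_moments a b f1 f2 ind).
Qed.


(** * Long range dependence *)

Lemma long_range_dependent_of_kernel d (T : measurableType d) (R : realType)
    (P : probability T R) (X : R -> {RV P >-> R}) (p q H K : R) :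
  0 <= p -> 0 < q -> 0 < H <= K -> K < 1 ->
  (forall t, 0 <= t -> centered_square_integrable (X t)) ->
  (forall t s, 0 <= t -> 0 <= s ->
    Corr (X t) (X s) = kernel_corr (mixed_kernel p q H K) t s) ->
  long_range_dependent X.
Proof.
move=> p0 q0 HK K1 X2 corrX; split=> //.
have K0 : 0 < K by case/andP: HK => H0; exact: lt_le_trans.
(* This exponent is min(K, 1 - K). *)
exists (K - Num.max 0 (2 * K - 1)); split.
  by case: (leP 0 (2 * K - 1)) => Khalf; apply/andP; split; lra.
move=> s s0; have [c c0 lim] := mixed_kernel_corr_cvgy p0 q0 HK s0.
exists c; rewrite /asymp_equiv opprB.
rewrite -[X in _ --> X](divff (lt0r_neq0 c0)).
apply: cvg_trans (cvgM lim (cvg_cst c^-1)).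
apply: near_eq_cvg; near=> t => /=.
have t0 : 0 < t by near: t; exact: nbhs_pinfty_gt.
by rewrite corrX ?ltW// invfM mulrA mulrAC.
Unshelve. all: by end_near. Qed.

Theorem corollary2p13 (d : measure_display) (T : measurableType d)
  (R : realType) (P : probability T R) (H1 H2 a b : R)
  (B1 B2 : R -> {RV P >-> R}) :
  0 < H1 < 1 -> 0 < H2 < 1 -> H1 < H2 ->
  (a, b) != (0, 0) ->
  is_fBm H1 B1 -> is_fBm H2 B2 ->
  independent_processes B1 B2 ->
  long_range_dependent (fmfBm a b B1 B2).
Proof.
move=> /andP[H10 H11] /andP[H20 H21] H12 ab0 f1 f2 ind.
have N2 t := @fmfBm_centered_square_integrable _ _ _ _ _ _ a b _ _ t f1 f2.
have NC t s := @fmfBm_Corr _ _ _ _ _ _ a b _ _ t s f1 f2 ind.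
have [b0|b0] := eqVneq b 0; last first.
  apply: (long_range_dependent_of_kernel (p := a ^+ 2) (q := b ^+ 2)
    (H := H1) (K := H2)) => //; first exact: sqr_ge0.
    by rewrite exprn_even_gt0.
  by rewrite H10 ltW.
have a0 : a != 0 by move: ab0; rewrite b0 xpair_eqE eqxx andbT.
(* The dominant component is now a B1; the other one gets weight 0. *)
apply: (long_range_dependent_of_kernel (p := 0) (q := a ^+ 2)
  (H := H1) (K := H1)) => //; first by rewrite exprn_even_gt0.
  by rewrite H10 lexx.
move=> t s t0 s0; rewrite NC//.
by rewrite /kernel_corr /mixed_kernel b0 expr0n/= !mul0r !addr0 !add0r.
Qed.
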